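(* Let $q\in\mathbb{C}_p$ with $|1-q|_p<1$ and $q$ not a root of unity, and let $x\in\mathbb{Z}_p$. For every integer $r\ge1$ and every integer $n\ge0$, $$E_{n,q}^{(r,-r)}(x)=\frac{1}{2^r}\sum_{m=0}^r\frac{1}{[m]_q!}\sum_{k=0}^mS_1(m-1,k;q)(-1)^k[r]_q^{m-k}[x+m]_q^n.$$
   Context: $p$ is a fixed odd prime; $\mathbb{Z}_p$ is the ring of $p$-adic integers, $\mathbb{C}_p$ the completion of an algebraic closure of $\mathbb{Q}_p$, with $|p|_p=1/p$. For $x\in\mathbb{Z}_p$, $q^x=\sum_{k\ge0}\binom{x}{k}(q-1)^k$ and $[x]_q=\frac{1-q^x}{1-q}$; $[m]_q!=[m]_q[m-1]_q\cdots[1]_q$, $[0]_q!=1$. The fermionic $p$-adic integral of a uniformly differentiable function $f:\mathbb{Z}_p\to\mathbb{C}_p$ is $\int_{\mathbb{Z}_p}f(y)\,d\mu_{-1}(y)=\lim_{N\to\infty}\sum_{y=0}^{p^N-1}f(y)(-1)^y$; multiple integrals are iterated. For $h\in\mathbb{Z}$, $r\ge1$, $n\ge0$, the extended higher-order Nörlund type $q$-Euler polynomials are $$E_{n,q}^{(h,-r)}(x)=\frac{1}{(1-q)^n}\sum_{l=0}^n\frac{\binom{n}{l}(-1)^lq^{lx}}{\int_{\mathbb{Z}_p}\cdots\int_{\mathbb{Z}_p}q^{l(x_1+\cdots+x_r)}q^{\sum_{j=1}^r(h-j)x_j}\,d\mu_{-1}(x_1)\cdots d\mu_{-1}(x_r)};$$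 $E_{n,q}^{(r,-r)}(x)$ is the case $h=r$. The $q$-Stirling numbers of the first kind $S_1(n,k;q)$ are defined for $n\ge0$ by $\prod_{k=1}^n(1+[k]_qz)=\sum_{k=0}^nS_1(n,k;q)z^k$, with $S_1(n,k;q)=0$ for $k>n\ge0$, and by convention $S_1(-1,0;q)=1$. *)

(* Defs.v *)
From HB Require Import structures.
From mathcomp Require Import all_boot all_order all_algebra.
From mathcomp Require Import all_classical all_reals all_analysis.

Set Implicit Arguments.
Unset Strict Implicit.
Unset Printing Implicit Defensive.

Import Order.TTheory GRing.Theory Num.Theory.

Local Open Scope classical_set_scope.
Local Open Scope ring_scope.

(* Fields with a real-valued non-archimedean absolute value.  The norm of
   [normedZmodType] cannot be used for it: the axiom `|x *+ n| = `|x| *+ n of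
   that structure makes the norm archimedean. *)
Record ultraField (R : realType) := UltraField {
  ultra_field : fieldType ;
  ultra_abs : ultra_field -> R ;
  ultra_abs_ge0 : forall x, 0 <= ultra_abs x ;
  ultra_abs_eq0 : forall x, ultra_abs x = 0 <-> x = 0 ;
  ultra_absM : forall x y, ultra_abs (x * y) = ultra_abs x * ultra_abs y ;
  ultra_absD : forall x y,
    ultra_abs (x + y) <= Num.max (ultra_abs x) (ultra_abs y)
}.

(* The carrier is a type constructor of its own, so that the metric structure
   below is attached to it. *)
Definition ultra_sort (R : realType) (K : ultraField R) : Type := ultra_field K.
Coercion ultra_sort : ultraField >-> Sortclass.

HB.instance Definition _ (R : realType) (K : ultraField R) :=
  GRing.Field.copy (ultra_sort K) (ultra_field K).

Section UltraMetric.
Context (R : realType) (K : ultraField R).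

Definition vabs (x : K) : R := ultra_abs x.

Lemma vabs_ge0 (x : K) : 0 <= vabs x.
Proof. exact: ultra_abs_ge0. Qed.

Lemma vabs_eq0 (x : K) : vabs x = 0 <-> x = 0.
Proof. exact: ultra_abs_eq0. Qed.

Lemma vabsM (x y : K) : vabs (x * y) = vabs x * vabs y.
Proof. exact: ultra_absM. Qed.

Lemma vabsD (x y : K) : vabs (x + y) <= Num.max (vabs x) (vabs y).
Proof. exact: ultra_absD. Qed.

Lemma vabs1 : vabs (1 : K) = 1.
Proof.
have v0 : vabs (1 : K) != 0.
  by apply/eqP => /vabs_eq0 /eqP; rewrite oner_eq0.
by apply: (mulfI v0); rewrite -vabsM !mulr1.
Qed.

Lemma vabsN (x : K) : vabs (- x) = vabs x.
Proof.
have vN1 : vabs (-1 : K) = 1.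
  apply/eqP; rewrite -(@pexpr_eq1 _ _ 2) ?vabs_ge0 //.
  by rewrite expr2 -vabsM mulrNN mulr1 vabs1.
by rewrite -mulN1r vabsM vN1 mul1r.
Qed.

Definition vdist (x y : K) : R := vabs (x - y).

Lemma vdistxx (x : K) : vdist x x = 0.
Proof. by apply/vabs_eq0; rewrite subrr. Qed.

Lemma vdist_eq0 (x y : K) : vdist x y = 0 -> x = y.
Proof. by move=> /vabs_eq0 /eqP; rewrite subr_eq0 => /eqP. Qed.

Lemma vdistC (x y : K) : vdist x y = vdist y x.
Proof. by rewrite /vdist -vabsN opprB. Qed.

Lemma vdist_triangle (y x z : K) : vdist x z <= vdist x y + vdist y z.
Proof.
rewrite /vdist -(subrKA y x (- z)); apply: le_trans (vabsD _ _) _.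
by rewrite ge_max lerDl lerDr !vabs_ge0.
Qed.

HB.instance Definition _ := isPointed.Build (ultra_sort K) (0 : K).
HB.instance Definition _ := @isMetric.Build R (ultra_sort K) vdist
  vdistxx vdist_eq0 vdistC vdist_triangle.

Definition ultra_complete : Prop :=
  forall F : set_system K, ProperFilter F -> cauchy F -> cvg F.

Definition unit_ball : {pred K} := fun x => vabs x <= 1.

Lemma unit_ball_subring : subring_closed unit_ball.
Proof.
split; rewrite ?unfold_in /unit_ball ?vabs1 //.
- move=> x y; rewrite !unfold_in => hx hy.
  by apply: le_trans (vabsD _ _) _; rewrite vabsN ge_max hx hy.
- by move=> x y; rewrite !unfold_in => hx hy; rewrite vabsM mulr_ile1 ?vabs_ge0.
Qed.

HB.instance Definition _ :=
  GRing.isSubringClosed.Build (ultra_sort K) unit_ball unit_ball_subring.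

End UltraMetric.

(* The absolute value of rat with |p| = 1 / p; the two valuations are those
   of the numerator and of the denominator. *)
Definition padic_abs (R : realType) (p : nat) (a : rat) : R :=
  if a == 0 then 0
  else p%:R ^ ((logn p `|denq a|%N)%:Z - (logn p `|numq a|%N)%:Z).

(* The library constructs neither Q_p nor its algebraic closures, so C_p is
   given by its defining tower, which determines it up to isometric
   isomorphism: Qp is a completion of the rationals for the p-adic absolute
   value, Qpbar is an algebraic closure of Qp whose absolute value extends
   that of Qp, and Cp is a completion of Qpbar. *)
Record padic_tower (R : realType) (p : nat) := PadicTower {
  Qp : ultraField R ;
  Qp_complete : ultra_complete Qp ;
  Qp_of_rat : {rmorphism rat -> Qp} ;
  Qp_of_rat_abs : forall a, vabs (Qp_of_rat a) = padic_abs R p a ;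
  Qp_of_rat_dense : dense (range Qp_of_rat) ;
  Qpbar : ultraField R ;
  Qpbar_of_Qp : {rmorphism Qp -> Qpbar} ;
  Qpbar_of_Qp_abs : forall a, vabs (Qpbar_of_Qp a) = vabs a ;
  Qpbar_algebraic : forall z, algebraicOver Qpbar_of_Qp z ;
  Qpbar_closed : GRing.closed_field_axiom Qpbar ;
  Cp : ultraField R ;
  Cp_complete : ultra_complete Cp ;
  Cp_of_Qpbar : {rmorphism Qpbar -> Cp} ;
  Cp_of_Qpbar_abs : forall z, vabs (Cp_of_Qpbar z) = vabs z ;
  Cp_of_Qpbar_dense : dense (range Cp_of_Qpbar)
}.

(* The ring Z_p, as the closed unit ball of Qp. *)
Record padic_int (R : realType) (p : nat) (T : padic_tower R p) := PadicInt {
  padic_int_val :> Qp T ;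
  padic_int_valP : padic_int_val \in unit_ball (K := Qp T)
}.

HB.instance Definition _ (R : realType) (p : nat) (T : padic_tower R p) :=
  [isSub of padic_int T for @padic_int_val R p T].
HB.instance Definition _ (R : realType) (p : nat) (T : padic_tower R p) :=
  [Choice of padic_int T by <:].
HB.instance Definition _ (R : realType) (p : nat) (T : padic_tower R p) :=
  [SubChoice_isSubComNzRing of padic_int T by <:].

Definition Cp_of_Qp (R : realType) (p : nat) (T : padic_tower R p) (a : Qp T) :
  Cp T := Cp_of_Qpbar T (Qpbar_of_Qp T a).

Definition padic_binom (R : realType) (p : nat) (T : padic_tower R p)
    (x : padic_int T) (k : nat) : Qp T :=
  (\prod_(i < k) (padic_int_val x - i%:R)) / k`!%:R.

Definition qpow (R : realType) (p : nat) (T : padic_tower R p)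
    (q : Cp T) (x : padic_int T) : Cp T :=
  limn (series (fun k : nat => Cp_of_Qp (padic_binom x k) * (q - 1) ^+ k)).

Definition qnum (R : realType) (p : nat) (T : padic_tower R p)
    (q : Cp T) (x : padic_int T) : Cp T :=
  (1 - qpow q x) / (1 - q).

Definition qfact (R : realType) (p : nat) (T : padic_tower R p)
    (q : Cp T) (m : nat) : Cp T :=
  \prod_(1 <= i < m.+1) qnum q i%:R.

(* As for every [lim], the value is meaningful only when the limit exists, in
   particular when f is uniformly differentiable. *)
Definition fermionic_int (R : realType) (p : nat) (T : padic_tower R p)
    (f : padic_int T -> Cp T) : Cp T :=
  limn (fun N : nat => \sum_(0 <= y < p ^ N) f y%:R * (-1) ^+ y).

(* The iterated integral in d mu(x_1) ... d mu(x_r), with x_1 innermost. *)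
Fixpoint fermionic_mint (R : realType) (p : nat) (T : padic_tower R p)
    (r : nat) : (r.-tuple (padic_int T) -> Cp T) -> Cp T :=
  match r with
  | 0 => fun f => f [tuple]
  | r'.+1 => fun f =>
      fermionic_mint (fun xs : r'.-tuple (padic_int T) =>
        fermionic_int (fun x => f [tuple of x :: xs]))
  end.

(* The polynomial E_{n,q}^{(h,-r)}(x); the variable x_j of the integral is
   [tnth xs j] with indices starting at 0, hence the j.+1. *)
Definition qEuler (R : realType) (p : nat) (T : padic_tower R p)
    (q : Cp T) (h : int) (r n : nat) (x : padic_int T) : Cp T :=
  1 / (1 - q) ^+ n *
  \sum_(l < n.+1)
    ('C(n, l)%:R * (-1) ^+ l * qpow q (l%:R * x)) /
    fermionic_mint (fun xs : r.-tuple (padic_int T) =>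
      qpow q (l%:R * \sum_(j < r) tnth xs j) *
      qpow q (\sum_(j < r) (h - j.+1%:Z)%:~R * tnth xs j)).

(* S_1(n, k; q) for n >= -1.  The first index is an integer because of the
   convention S_1(-1, 0; q) = 1; the values at the other negative first
   indices, and at (-1, k) with k > 0, are irrelevant. *)
Definition qStirling1 (R : realType) (p : nat) (T : padic_tower R p)
    (q : Cp T) (n : int) (k : nat) : Cp T :=
  match n with
  | Posz n' => (\prod_(1 <= i < n'.+1) (1 + (qnum q i%:R) *: 'X))`_k
  | Negz _ => (k == 0%N)%:R
  end.

(* Main.v *)
Require Import Defs.
From mathcomp Require Import all_boot all_order all_algebra.
From mathcomp Require Import all_classical all_reals all_analysis.
From mathcomp Require Import ring zify.

(** Why the formula holds.

    For an exponent [a], the sum of the [(- q ^+ a) ^+ y] over [y < p ^ N] is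
    geometric, equal to [(1 + q ^+ (a * p ^ N)) / (1 + q ^+ a)] because
    [p ^ N] is odd.  As [q] is close to 1, [q ^+ (a * p ^ N)] tends to 1, so
    the fermionic integral of [q ^ (a x)] is [2 / (1 + q ^+ a)]
    ([fermionic_int_qpow]); the denominator is nonzero since 2 is a unit at an
    odd prime.  The integrand in the definition of the polynomial is a product
    of such exponentials, one in each variable, with exponents
    [l + r - 1, ..., l], so the l-th denominator is
    [2 ^+ r / \prod_(i < r) (1 + q ^+ i * q ^+ l)]
    ([fermionic_mint_qEuler]).

    Its inverse is therefore a product to which the q-binomial theorem
    ([qbinomial]) applies: it becomes a combination of the [q ^+ (l * m)].
    Exchanging the sums over [l] and [m], the sum over [l] is the binomial
    expansion of [[x + m]_q ^+ n] ([qint_expr_expand]), and what remains is to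
    recognise the q-binomial coefficients.  The coefficient of index [m] is
    [\prod_(i < m) ([r]_q - [i]_q)] over the q-factorial of [m], and the
    generating function of the q-Stirling numbers, evaluated at
    [- 1 / [r]_q] and homogenised, gives that product
    ([stirling_ffact]).

    Two analytic facts support this.  The binomial coefficients of a p-adic
    integer are p-adic integers ([vabs_padic_binom_le1]), because the natural
    numbers are dense among the p-adic integers; so the partial sums of [qpow]
    converge geometrically.  And [qpow] turns sums into products ([qpowD]), by
    the Vandermonde identity ([padic_binomD]) and a bound on the error made when
    multiplying truncated power series ([vabs_cauchy_product]).  All limits
    below are controlled by explicit geometric rates. *)

Set Implicit Arguments.
Unset Strict Implicit.
Unset Printing Implicit Defensive.

Import Order.TTheory GRing.Theory Num.Theory numFieldNormedType.Exports.

Local Open Scope ring_scope.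

(** * Ultrametric estimates and limits with a geometric rate *)

Section UltraLimits.
Local Open Scope classical_set_scope.
Local Open Scope ring_scope.
Context {R : realType} {K : ultraField R}.
Implicit Types (u : nat -> K) (rho : R).

Lemma ball_vabs (x y : K) (e : R) : ball x e y = (vabs (x - y) < e).
Proof. by rewrite ballEmdist. Qed.

Lemma vabsX (x : K) n : vabs (x ^+ n) = vabs x ^+ n.
Proof. by elim: n => [|n IH]; rewrite ?expr0 ?vabs1 // !exprS vabsM IH. Qed.

Lemma vabsV (x : K) : vabs x^-1 = (vabs x)^-1.
Proof.
have [->|x0] := eqVneq x 0; first by rewrite invr0 (vabs_eq0 0).2 // invr0.
have v0 : vabs x != 0 by apply: contraNneq x0 => /vabs_eq0 ->.
by apply: (mulfI v0); rewrite -vabsM !divff ?vabs1.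
Qed.

Lemma vabs_nat n : vabs (n%:R : K) <= 1.
Proof. exact: (rpred_nat (unit_ball (K := K))). Qed.

Lemma vabs_int_le1 (z : int) : vabs (z%:~R : K) <= 1.
Proof. exact: (rpred_int (unit_ball (K := K))). Qed.

Lemma vabs_sum_le (I : Type) (s : seq I) (P : pred I) (F : I -> K) (c : R) :
  0 <= c -> (forall i, P i -> vabs (F i) <= c) ->
  vabs (\sum_(i <- s | P i) F i) <= c.
Proof.
move=> c0 Fc; elim/big_ind : _ => [|x y xc yc|//]; first by rewrite (vabs_eq0 0).2.
by rewrite (le_trans (vabsD _ _))// ge_max xc.
Qed.

Lemma vabs_prod (I : Type) (s : seq I) (P : pred I) (F : I -> K) :
  vabs (\prod_(i <- s | P i) F i) = \prod_(i <- s | P i) vabs (F i).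
Proof. by apply: big_morph; [exact: vabsM|exact: vabs1]. Qed.

(** Replacing the factors one at a time, each replacement changes a product of
    integral elements by at most [c]; the ultrametric inequality then prevents
    the errors from accumulating. *)
Lemma vabs_prodB (F G : nat -> K) (c : R) n :
  (forall i, vabs (F i) <= 1) -> (forall i, vabs (G i) <= 1) ->
  (forall i, vabs (F i - G i) <= c) -> 0 <= c ->
  vabs (\prod_(i < n) F i - \prod_(i < n) G i) <= c.
Proof.
move=> F1 G1 FG c0; elim: n => [|n IH].
  by rewrite !big_ord0 subrr (vabs_eq0 0).2.
rewrite !big_ord_recr /=.
set f := \prod_(i < n) F i; set g := \prod_(i < n) G i.
have -> : f * F n - g * G n = (f - g) * F n + g * (F n - G n) by ring.
rewrite (le_trans (vabsD _ _))// ge_max !vabsM; apply/andP; split.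
  by rewrite (le_trans _ IH)// ler_piMr ?vabs_ge0.
rewrite (le_trans _ (FG n))// ler_piMl ?vabs_ge0// vabs_prod.
by apply: prodr_ile1 => i _; rewrite vabs_ge0 G1.
Qed.

(** The strict triangle principle: [x = (x + y) - y] would be small if both
    terms were. *)
Lemma vabsD_eq1 (x y : K) : vabs x = 1 -> vabs y < 1 -> vabs (x + y) = 1.
Proof.
move=> x1 y1; apply/eqP; rewrite eq_le; apply/andP; split.
  by rewrite (le_trans (vabsD _ _))// ge_max x1 lexx ltW.
rewrite leNgt; apply/negP => xy1.
have : vabs (x + y - y) < 1.
  by rewrite (le_lt_trans (vabsD _ _))// vabsN gt_max xy1 y1.
by rewrite addrK x1 ltxx.
Qed.

Lemma geometric_lt rho (e : R) : 0 <= rho < 1 -> 0 < e ->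
  \forall n \near \oo, rho ^+ n < e.
Proof.
case/andP => rho0 rho1 e0.
have rho1' : `|rho| < 1 by rewrite ger0_norm.
exact: (cvgr_lt _ (cvg_expr rho1') e e0).
Qed.

Lemma lim_geometric (C : R) rho u (l : K) : 0 <= C -> 0 <= rho < 1 ->
  (forall n, vabs (u n - l) <= C * rho ^+ n) -> limn u = l.
Proof.
move=> C0 rho01 ul; apply: cvg_lim; first exact: metric_hausdorff.
apply/cvg_ballP => e e0.
have C1 : 0 < C + 1 by rewrite ltr_pwDr.
have := geometric_lt rho01 (divr_gt0 e0 C1).
apply: filterS => n; rewrite ltr_pdivlMr// => rn.
rewrite ball_vabs -vabsN opprB (le_lt_trans (ul n))// (le_lt_trans _ rn)//.
by rewrite mulrC ler_wpM2l ?lerDl// exprn_ge0//; case/andP: rho01.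
Qed.

(** In an ultrametric, a telescoping sum is no larger than its largest term,
    so bounds on consecutive differences are bounds on all differences. *)
Lemma geometric_cauchy rho u : 0 <= rho < 1 ->
  (forall n, vabs (u n.+1 - u n) <= rho ^+ n) ->
  forall n m, (n <= m)%N -> vabs (u n - u m) <= rho ^+ n.
Proof.
case/andP => rho0 rho1 du n m nm.
rewrite -opprB vabsN -(telescope_sumr u nm) big_nat_cond.
apply: vabs_sum_le; first exact: exprn_ge0.
move=> i /andP[/andP[ni _] _]; apply: le_trans (du i) _.
by rewrite ler_wiXn2l// ltW.
Qed.

(** The limit inherits the rate: if [u n] were further than [rho ^+ n] from the
    limit, some later [u m] close to the limit would be too far from [u n]. *)
Lemma lim_geometric_le rho u : ultra_complete K -> 0 <= rho < 1 ->
  (forall n, vabs (u n.+1 - u n) <= rho ^+ n) ->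
  forall n, vabs (u n - limn u) <= rho ^+ n.
Proof.
move=> Kc rho01 du; have dum := geometric_cauchy rho01 du.
have [rho0 _] := andP rho01.
have /cvg_ballP cu : cvgn u.
  apply: Kc; apply: cauchy_exP => e e0.
  have [N _ rN] := geometric_lt rho01 e0.
  exists (u N); exists N => // n /= Nn; rewrite ball_vabs.
  exact: le_lt_trans (dum _ _ Nn) (rN N (leqnn N)).
move=> n; have [->|rn0] := eqVneq (vabs (u n - limn u)) 0.
  exact: exprn_ge0.
have e0 : 0 < vabs (u n - limn u) by rewrite lt_neqAle eq_sym rn0 vabs_ge0.
have [N _ uN] := cu _ e0.
rewrite leNgt; apply/negP => rnu.
pose m := maxn n N.
have := uN m (leq_maxr n N); rewrite /= ball_vabs => lm.
have : vabs ((u n - u m) + (u m - limn u)) < vabs (u n - limn u).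
  apply: le_lt_trans (vabsD _ _) _; rewrite gt_max.
  by rewrite (le_lt_trans (dum _ _ (leq_maxl n N)))// -vabsN opprB.
by rewrite subrKA ltxx.
Qed.

(** The truncations of [a] and [b] are polynomials whose product agrees with
    the Cauchy product below degree [n]; the remaining coefficients are
    integral and multiply powers of [t] of degree at least [n]. *)
Lemma vabs_cauchy_product (a b : nat -> K) (t : K) n :
  (forall i, vabs (a i) <= 1) -> (forall i, vabs (b i) <= 1) -> vabs t <= 1 ->
  vabs ((\sum_(i < n) a i * t ^+ i) * (\sum_(i < n) b i * t ^+ i) -
    \sum_(k < n) (\sum_(i < k.+1) a i * b (k - i)%N) * t ^+ k) <= vabs t ^+ n.
Proof.
move=> a1 b1 t1.
pose P := \poly_(i < n) a i; pose Q := \poly_(i < n) b i.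
have PQt : (\sum_(i < n) a i * t ^+ i) * (\sum_(i < n) b i * t ^+ i) = (P * Q).[t].
  by rewrite hornerM !horner_poly.
have sPQ : (size (P * Q)%R <= n + n)%N.
  rewrite (leq_trans (size_polyMleq _ _))// (leq_trans (leq_pred _))//.
  by rewrite leq_add ?size_poly.
rewrite PQt (horner_coef_wide _ sPQ) big_split_ord /=.
rewrite [X in X + _ - _](_ : _ =
    \sum_(k < n) (\sum_(i < k.+1) a i * b (k - i)%N) * t ^+ k).
  rewrite addrAC subrr add0r; apply: vabs_sum_le; first by
    rewrite exprn_ge0 ?vabs_ge0.
  move=> k _; rewrite vabsM vabsX exprD mulrCA ler_piMr ?exprn_ge0 ?vabs_ge0//.
  rewrite mulr_ile1 ?exprn_ge0 ?vabs_ge0 ?exprn_ile1 ?vabs_ge0// coefM.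
  apply: vabs_sum_le => // i _; rewrite vabsM mulr_ile1 ?vabs_ge0// coef_poly.
    by case: ifP; rewrite ?a1// (vabs_eq0 0).2.
  by case: ifP; rewrite ?b1// (vabs_eq0 0).2.
apply: eq_bigr => k _; rewrite coefM; congr (_ * _); apply: eq_bigr => i _.
rewrite !coef_poly (leq_ltn_trans (leq_ord i) (ltn_ord k)).
by rewrite (leq_ltn_trans (leq_subr _ _) (ltn_ord k)).
Qed.

Lemma vabs_exprB1 (u : K) n : vabs u <= 1 -> vabs (u ^+ n - 1) <= vabs (u - 1).
Proof.
move=> u1; rewrite subrX1 vabsM ler_piMr ?vabs_ge0//.
by apply: vabs_sum_le => // i _; rewrite vabsX exprn_ile1 ?vabs_ge0.
Qed.

(** Each n-th power gains a factor [rho], because [v ^+ n - 1] is [v - 1] times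
    the sum of the [v ^+ i], which differs from [n] by terms [v ^+ i - 1].
    Applied to [n = p], it makes [u ^+ (p ^ N)] tend to 1. *)
Lemma vabs_expr_powB1 (u : K) n rho N : vabs u <= 1 ->
  vabs (n%:R : K) <= rho -> vabs (u - 1) <= rho ->
  vabs (u ^+ (n ^ N) - 1) <= rho ^+ N.+1.
Proof.
move=> u1 nr ur; have rho0 : 0 <= rho by rewrite (le_trans _ ur)// vabs_ge0.
elim: N => [|N IH]; first by rewrite expn0 !expr1.
have v1 : vabs (u ^+ (n ^ N)) <= 1 by rewrite vabsX exprn_ile1 ?vabs_ge0.
rewrite expnSr exprM; set v := u ^+ (n ^ N) in v1 IH *.
rewrite subrX1 vabsM exprSr ler_pM ?vabs_ge0//.
have -> : \sum_(i < n) v ^+ i = n%:R + \sum_(i < n) (v ^+ i - 1).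
  by rewrite sumrB sumr_const card_ord addrC subrK.
rewrite (le_trans (vabsD _ _))// ge_max nr vabs_sum_le// => i _.
rewrite (le_trans (vabs_exprB1 _ v1))// (le_trans (vabs_exprB1 _ u1))//.
Qed.
End UltraLimits.

(** * Binomial coefficients of p-adic integers *)

Lemma prod_nat_binom {K : fieldType} (n k : nat) :
  \prod_(i < k) (n%:R - i%:R : K) = 'C(n, k)%:R * k`!%:R.
Proof.
rewrite -natrM bin_ffact; elim: k => [|k IH]; first by rewrite big_ord0.
rewrite big_ord_recr /= IH ffactnSr natrM.
have [kn|nk] := leqP k n; first by rewrite natrB.
by rewrite ffact_small// !mul0r.
Qed.

Section PadicNumbers.
Context {R : realType} {p : nat} (p_prime : prime p) (T : padic_tower R p).

Lemma padic_abs_nat n : (0 < n)%N ->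
  padic_abs R p n%:R = p%:R^-1 ^+ logn p n.
Proof.
move=> n0; rewrite /padic_abs pnatr_eq0 gtn_eqF//.
rewrite -[n%:R]/(n%:~R : rat) denq_int numq_int /= logn1 sub0r.
by rewrite exprVn -exprnN.
Qed.

Lemma vabs_Qp_nat n : (0 < n)%N ->
  vabs (n%:R : Qp T) = p%:R^-1 ^+ logn p n.
Proof.
by move=> n0; rewrite -padic_abs_nat// -(Qp_of_rat_abs T) rmorph_nat.
Qed.

Lemma Qp_nat_neq0 n : (0 < n)%N -> (n%:R : Qp T) != 0.
Proof.
by move=> n0; rewrite -(rmorph_nat (Qp_of_rat T)) fmorph_eq0 pnatr_eq0 -lt0n.
Qed.

Lemma padic_abs_le1_den (a : rat) : padic_abs R p a <= 1 ->
  coprime p `|denq a|.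
Proof.
have p1 := prime_gt1 p_prime.
rewrite prime_coprime//; apply: contraTN => pd.
have num : ~~ (p %| `|numq a|)%N.
  by rewrite -prime_coprime// (coprime_dvdl pd)// coprime_sym coprime_num_den.
rewrite /padic_abs ifF; last first.
  by apply: contraNF num; rewrite -numq_eq0 => /eqP ->; rewrite dvdn0.
rewrite (lognE p `|numq a|%N) (negPf num) !andbF subr0 -ltNge.
rewrite exprn_egt1 ?ltr1n// -lt0n logn_gt0 mem_primes p_prime pd andbT.
by rewrite absz_gt0 denq_neq0.
Qed.

(** If [w] inverts the denominator of [a] modulo [p ^ M], the residue of
    [numq a * w] modulo [p ^ M] is close to [a]. *)
Lemma rat_nat_approx (a : rat) M : padic_abs R p a <= 1 ->
  exists n : nat, vabs (Qp_of_rat T a - n%:R) <= p%:R^-1 ^+ M.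
Proof.
move=> a1; have cop := padic_abs_le1_den a1.
have /coprimezP[[w s] /= ws] : coprimez (denq a) (p ^ M)%:Z.
  by rewrite coprimezE /= coprimeXr// coprime_sym.
have pM0 : (p ^ M)%:Z != 0 by rewrite -lt0n expn_gt0 prime_gt0.
pose c := (numq a * w)%R.
have nE : (`|(c %% (p ^ M)%:Z)%Z|%N : int) = (c %% (p ^ M)%:Z)%Z.
  by rewrite gez0_abs// modz_ge0.
exists `|(c %% (p ^ M)%:Z)%Z|%N.
have d0 : ((denq a)%:~R : Qp T) != 0.
  by rewrite -(rmorph_int (Qp_of_rat T)) fmorph_eq0 intr_eq0 denq_neq0.
have d1 : vabs ((denq a)%:~R : Qp T) = 1.
  rewrite -absz_denq -pmulrn vabs_Qp_nat ?absz_gt0 ?denq_neq0//.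
  rewrite (lognE p) ifF ?expr0// -[(p %| _)%N]negbK -prime_coprime// cop.
  by rewrite !andbF.
have aE : Qp_of_rat T a = (numq a)%:~R / (denq a)%:~R.
  by rewrite -[in LHS](divq_num_den a) fmorph_div !rmorph_int.
have -> : Qp_of_rat T a - `|(c %% (p ^ M)%:Z)%Z|%:R =
    (p ^ M)%:R * (numq a * s + (c %/ (p ^ M)%:Z)%Z * denq a)%:~R / (denq a)%:~R.
  apply: (mulIf d0); rewrite divfK// mulrBl aE divfK//.
  rewrite (pmulrn _ `|_|%N) (pmulrn _ (p ^ M)%N) nE -!intrM -intrB; congr _%:~R.
  have -> : (c %% (p ^ M)%:Z)%Z = c - (c %/ (p ^ M)%:Z)%Z * (p ^ M)%:Z.
    by rewrite {2}(divz_eq c (p ^ M)%:Z) addrC addKr.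
  rewrite -{1}[numq a]mulr1 -ws /c; ring.
rewrite !vabsM vabsV d1 invr1 mulr1 vabs_Qp_nat ?expn_gt0 ?prime_gt0//.
by rewrite pfactorK// ler_piMr ?vabs_int_le1// exprn_ge0// invr_ge0.
Qed.

(** Density of the natural numbers in the p-adic integers: a rational close
    enough to [x] is p-integral, since [x] is. *)
Lemma padic_int_nat_approx (x : padic_int T) (e : R) : 0 < e ->
  exists n : nat, vabs (padic_int_val x - n%:R) < e.
Proof.
move=> e0.
have invp1 : 0 <= (p%:R^-1 : R) < 1.
  by rewrite invr_ge0 ler0n invf_lt1 ?ltr1n ?ltr0n ?prime_gt0 ?prime_gt1.
have [M _ Me] := geometric_lt invp1 e0.
(* The bound 1 on the distance makes the rational approximation p-integral. *)
pose d := Num.min e 1.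
have d0 : 0 < d by rewrite lt_min e0 ltr01.
pose B := interior (ball (padic_int_val x) d).
have [||a [Ba [b _ ab]]] := @Qp_of_rat_dense _ _ T B.
- by exists (padic_int_val x); exact: nbhsx_ballx.
- exact: open_interior.
have := interior_subset Ba; rewrite ball_vabs lt_min -ab => /andP[xe x1].
have b1 : padic_abs R p b <= 1.
  rewrite -(Qp_of_rat_abs T) -[Qp_of_rat T b](subKr (padic_int_val x)).
  rewrite (le_trans (vabsD _ _))// vabsN ge_max (ltW x1) andbT.
  exact: padic_int_valP.
have [n bn] := rat_nat_approx M b1.
exists n; rewrite -(subrKA (Qp_of_rat T b)) (le_lt_trans (vabsD _ _))//.
by rewrite gt_max xe (le_lt_trans bn)// Me /=.
Qed.

Lemma padic_binom_nat n k : padic_binom (n%:R : padic_int T) k = 'C(n, k)%:R.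
Proof.
have -> : padic_binom (n%:R : padic_int T) k =
    (\prod_(i < k) (n%:R - i%:R)) / k`!%:R.
  by rewrite /padic_binom -[padic_int_val _]/(val _) rmorph_nat.
by rewrite prod_nat_binom mulfK// Qp_nat_neq0// fact_gt0.
Qed.

(** The numerator of the binomial coefficient is a product of integral factors,
    so it moves by less than [vabs k`!] when [x] is replaced by a natural
    number within [vabs k`!] of it, where the coefficient is an integer. *)
Lemma vabs_padic_binom_le1 (x : padic_int T) k : vabs (padic_binom x k) <= 1.
Proof.
have k0 : 0 < vabs (k`!%:R : Qp T).
  by rewrite vabs_Qp_nat ?fact_gt0// exprn_gt0// invr_gt0 ltr0n prime_gt0.
have [n xn] := padic_int_nat_approx x k0.
have U (y : padic_int T) i : vabs (padic_int_val y - i%:R) <= 1.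
  apply: (rpredB (S := unit_ball (K := Qp T))); first exact: padic_int_valP.
  exact: vabs_nat.
rewrite -[padic_binom x k](subrK (padic_binom (n%:R : padic_int T) k)).
rewrite (le_trans (vabsD _ _))// ge_max; apply/andP; split; last first.
  by rewrite padic_binom_nat vabs_nat.
rewrite /padic_binom -mulrBl vabsM vabsV ler_pdivrMr// mul1r.
apply: (vabs_prodB (F := fun i => _ - i%:R) (G := fun i => _ - i%:R));
  rewrite ?vabs_ge0//.
move=> i; rewrite opprB addrA subrK ltW//.
by rewrite -[X in _ - X]/(val _) rmorph_nat.
Qed.

Lemma padic_binomS (x : padic_int T) k :
  padic_binom x k.+1 * k.+1%:R = padic_binom x k * (padic_int_val x - k%:R).
Proof.
rewrite /padic_binom big_ord_recr /= factS natrM invfM.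
by rewrite [_^-1 * _]mulrC mulrA divfK ?Qp_nat_neq0// mulrAC.
Qed.

(** Vandermonde, by induction on [n]: multiplying by [n + 1] brings in the
    factor [(x + y) - n = (x - i) + (y - (n - i))], and each half raises one of
    the two indices. *)
Lemma padic_binomD (x y : padic_int T) n :
  padic_binom (x + y) n =
  \sum_(i < n.+1) padic_binom x i * padic_binom y (n - i).
Proof.
elim: n => [|n IH].
  by rewrite big_ord1 /padic_binom !big_ord0 /= fact0 divr1 mulr1.
apply: (mulIf (@Qp_nat_neq0 n.+1 isT)); rewrite padic_binomS IH.
pose b i := padic_binom x i; pose c i := padic_binom y i.
transitivity (\sum_(i < n.+1) (b i.+1 * i.+1%:R * c (n - i)%N) +
    \sum_(i < n.+1) (b i * (c (n - i).+1 * (n - i).+1%:R))).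
  rewrite -big_split mulr_suml; apply: eq_bigr => i _ /=.
  by rewrite /b /c !padic_binomS natrB ?leq_ord//; ring.
have splitE (i : 'I_n.+2) : true -> padic_binom x i * padic_binom y (n.+1 - i) *
      n.+1%:R = b i * i%:R * c (n.+1 - i)%N + b i * (c (n.+1 - i)%N * (n.+1 - i)%:R).
  have -> : n.+1%:R = i%:R + (n.+1 - i)%:R :> Qp T.
    by rewrite -natrD subnKC ?leq_ord.
  by move=> _; rewrite /b /c; ring.
rewrite mulr_suml (eq_bigr _ splitE) big_split /=; congr (_ + _).
  by rewrite [RHS]big_ord_recl /= mulr0 mul0r add0r.
rewrite [RHS]big_ord_recr /= subnn !mulr0 addr0.
by apply: eq_bigr => i _; rewrite subSn ?leq_ord.
Qed.
End PadicNumbers.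

(** * The q-power and its fermionic integrals *)

Section QPowers.
Context {R : realType} {p : nat} (p_prime : prime p) (p_odd : odd p).
Context {T : padic_tower R p} {q : Cp T} (q_near1 : vabs (1 - q) < 1).

Lemma vabs_Cp_of_Qp (a : Qp T) : vabs (Cp_of_Qp a) = vabs a.
Proof. by rewrite /Cp_of_Qp Cp_of_Qpbar_abs Qpbar_of_Qp_abs. Qed.

Lemma Cp_of_Qp_nat n : Cp_of_Qp (n%:R : Qp T) = n%:R.
Proof. by rewrite /Cp_of_Qp !rmorph_nat. Qed.

Lemma vabs_qB1 : 0 <= vabs (q - 1) < 1.
Proof. by rewrite vabs_ge0 -vabsN opprB. Qed.

Lemma vabs_q : vabs q = 1.
Proof.
rewrite -[q](subrK 1) addrC; apply: vabsD_eq1; first exact: vabs1.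
by case/andP: vabs_qB1.
Qed.

Lemma vabs_Cp_p : vabs (p%:R : Cp T) < 1.
Proof.
rewrite -Cp_of_Qp_nat vabs_Cp_of_Qp vabs_Qp_nat ?prime_gt0//.
rewrite -{3}(expn1 p) pfactorK// expr1 invf_lt1 ?ltr1n ?prime_gt1//.
by rewrite ltr0n prime_gt0.
Qed.

Lemma vabs_Cp_2 : vabs (2 : Cp T) = 1.
Proof.
rewrite -[2](Cp_of_Qp_nat 2) vabs_Cp_of_Qp vabs_Qp_nat//.
rewrite lognE p_prime /= (_ : (p %| 2)%N = false) ?expr0//.
apply/negP; rewrite dvdn_prime2// => /eqP p2.
by move: p_odd; rewrite p2.
Qed.

Definition qpow_sum (x : padic_int T) (n : nat) : Cp T :=
  \sum_(k < n) Cp_of_Qp (padic_binom x k) * (q - 1) ^+ k.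

Lemma qpowE x : qpow q x = limn (qpow_sum x).
Proof.
rewrite /qpow; congr (limn _); apply/funext => n.
by rewrite /series /= big_mkord.
Qed.

Lemma vabs_qpow_coef x k : vabs (Cp_of_Qp (padic_binom x k) : Cp T) <= 1.
Proof. by rewrite vabs_Cp_of_Qp vabs_padic_binom_le1. Qed.

Lemma vabs_qpow_sumS x n :
  vabs (qpow_sum x n.+1 - qpow_sum x n) <= vabs (q - 1) ^+ n.
Proof.
rewrite /qpow_sum big_ord_recr /= addrAC subrr add0r vabsM vabsX.
by rewrite ler_piMl ?exprn_ge0 ?vabs_ge0// vabs_qpow_coef.
Qed.

Lemma qpow_approx x n : vabs (qpow_sum x n - qpow q x) <= vabs (q - 1) ^+ n.
Proof.
rewrite qpowE; apply: lim_geometric_le; first exact: Cp_complete.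
- exact: vabs_qB1.
- exact: vabs_qpow_sumS.
Qed.

Lemma vabs_qpow_sum_le1 x n : vabs (qpow_sum x n) <= 1.
Proof.
have /andP[_ q1] := vabs_qB1.
apply: vabs_sum_le => // k _; rewrite vabsM vabsX.
by rewrite mulr_ile1 ?exprn_ge0 ?vabs_ge0 ?vabs_qpow_coef ?exprn_ile1 ?vabs_ge0 ?ltW.
Qed.

Lemma vabs_qpow_le1 x : vabs (qpow q x) <= 1.
Proof.
have := qpow_approx x 0; rewrite /qpow_sum big_ord0 sub0r vabsN.
by rewrite expr0.
Qed.

(** At every order [n] the product of the partial sums differs from the partial
    sum at [x + y], and each partial sum from its limit, by at most
    [vabs (q - 1) ^+ n]. *)
Lemma qpowD x y : qpow q (x + y) = qpow q x * qpow q y.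
Proof.
rewrite qpowE; apply: (lim_geometric ler01 vabs_qB1) => n; rewrite mul1r.
have sumD : qpow_sum (x + y) n = \sum_(k < n) (\sum_(i < k.+1)
    Cp_of_Qp (padic_binom x i) * Cp_of_Qp (padic_binom y (k - i))) * (q - 1) ^+ k.
  apply: eq_bigr => k _; rewrite padic_binomD /Cp_of_Qp !rmorph_sum.
  by congr (_ * _); apply: eq_bigr => i _; rewrite !rmorphM.
have /andP[_ /ltW q1] := vabs_qB1.
have := vabs_cauchy_product n (vabs_qpow_coef x) (vabs_qpow_coef y) q1.
rewrite -sumD -/(qpow_sum x n) -/(qpow_sum y n) => prodn.
set a := qpow_sum x n in prodn *; set b := qpow_sum y n in prodn *.
have -> : qpow_sum (x + y) n - qpow q x * qpow q y =
    - (a * b - qpow_sum (x + y) n) + ((a - qpow q x) * b + qpow q x * (b - qpow q y)).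
  by ring.
rewrite (le_trans (vabsD _ _))// ge_max vabsN prodn /=.
rewrite (le_trans (vabsD _ _))// ge_max !vabsM; apply/andP; split.
  by rewrite (le_trans _ (qpow_approx x n))// ler_piMr ?vabs_ge0 ?vabs_qpow_sum_le1.
by rewrite (le_trans _ (qpow_approx y n))// ler_piMl ?vabs_ge0 ?vabs_qpow_le1.
Qed.

(** The partial sums at a natural number are finite binomial expansions of
    [(1 + (q - 1)) ^+ n] as soon as they have more than [n] terms. *)
Lemma qpow_nat n : qpow q n%:R = q ^+ n.
Proof.
rewrite qpowE; apply: (lim_geometric ler01 vabs_qB1) => m; rewrite mul1r.
suff -> : q ^+ n = qpow_sum n%:R (n.+1 + m).
  (* [n.+1 + m] terms: past the last nonzero one, and at least [m]. *)
  apply: geometric_cauchy; rewrite ?leq_addl//; first exact: vabs_qB1.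
  exact: vabs_qpow_sumS.
rewrite /qpow_sum big_split_ord /= [X in _ + X]big1 => [|i _].
  rewrite addr0 -{1}[q](subrK 1) addrC exprDn; apply: eq_bigr => i _.
  by rewrite padic_binom_nat Cp_of_Qp_nat expr1n mul1r mulr_natl.
by rewrite padic_binom_nat Cp_of_Qp_nat bin_small ?mul0r// leq_addr.
Qed.

Lemma qpow0 : qpow q 0 = 1.
Proof. exact: qpow_nat 0%N. Qed.

Lemma qpowMn a x : qpow q (a%:R * x) = qpow q x ^+ a.
Proof.
elim: a => [|a IH]; first by rewrite mul0r qpow0.
by rewrite -addn1 natrD mulrDl mul1r qpowD IH addn1 exprSr.
Qed.

Lemma qpow_sumE (I : Type) (s : seq I) (P : pred I) (F : I -> padic_int T) :
  qpow q (\sum_(i <- s | P i) F i) = \prod_(i <- s | P i) qpow q (F i).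
Proof. by apply: big_morph; [exact: qpowD|exact: qpow0]. Qed.

(** [1 + q ^+ a] is close to 2, which is a unit because [p] is odd. *)
Lemma qexp1_neq0 a : 1 + q ^+ a != 0.
Proof.
apply/eqP => /vabs_eq0; rewrite (_ : 1 + _ = 2 + (q ^+ a - 1)); last by ring.
rewrite vabsD_eq1 ?vabs_Cp_2//; first by move/eqP; rewrite oner_eq0.
have /andP[_ q1] := vabs_qB1.
by rewrite (le_lt_trans _ q1)// vabs_exprB1// vabs_q.
Qed.

(** The sums in the limit are geometric; the constant [c] is carried along so
    that the integrals can be iterated with the other variables fixed. *)
Lemma fermionic_int_qpow c a :
  fermionic_int (fun x => c * qpow q (a%:R * x)) = c * (2 / (1 + q ^+ a)).
Proof.
pose rho := Num.max (vabs (p%:R : Cp T)) (vabs (q - 1)).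
have rho01 : 0 <= rho < 1.
  have /andP[q0 q1] := vabs_qB1.
  by rewrite le_max q0 orbT gt_max vabs_Cp_p q1.
have C0 : 0 <= vabs (c / (1 + q ^+ a)) by exact: vabs_ge0.
rewrite /fermionic_int; apply: (lim_geometric C0 rho01) => N.
have d0 := qexp1_neq0 a; set u := q ^+ a in d0 *.
have u1 : vabs u <= 1 by rewrite vabsX vabs_q expr1n.
(* [rho] dominates both [p] and [q - 1], as [vabs_expr_powB1] requires. *)
have uN : vabs (u ^+ (p ^ N) - 1) <= rho ^+ N.
  have /andP[rho0 /ltW rho1] := rho01.
  apply: (le_trans (y := rho ^+ N.+1)); last by rewrite exprS ler_piMl ?exprn_ge0.
  apply: vabs_expr_powB1 => //; rewrite le_max ?lexx//.
  by rewrite vabs_exprB1 ?orbT// vabs_q.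
have -> : \sum_(0 <= y < p ^ N) c * qpow q (a%:R * y%:R) * (-1) ^+ y =
    c * ((1 + u ^+ (p ^ N)) / (1 + u)).
  rewrite big_mkord.
  under eq_bigr => i _.
    rewrite mulrC mulrCA -natrM qpow_nat exprM -/u -exprMn mulN1r; over.
  rewrite -mulr_sumr; congr (_ * _); apply: (mulIf d0); rewrite divfK//.
  have := subrX1 (- u) (p ^ N); rewrite exprNn -signr_odd oddX p_odd orbT expr1.
  by move=> uX; apply: oppr_inj; rewrite mulrC -mulNr opprD [-1 - u]addrC -uX; ring.
have -> : c * ((1 + u ^+ (p ^ N)) / (1 + u)) - c * (2 / (1 + u)) =
    c / (1 + u) * (u ^+ (p ^ N) - 1) by field.
by rewrite vabsM ler_wpM2l.
Qed.

Lemma fermionic_mint_qpow r (a : nat -> nat) c :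
  fermionic_mint (fun xs : r.-tuple (padic_int T) =>
    c * \prod_(j < r) qpow q ((a j)%:R * tnth xs j)) =
  c * \prod_(j < r) (2 / (1 + q ^+ a j)).
Proof.
elim: r a c => [|r IH] a c; first by rewrite /= !big_ord0.
rewrite [LHS]/= big_ord_recl mulrA -(IH (fun j => a j.+1)).
congr fermionic_mint; apply/funext => xs.
rewrite mulrAC -fermionic_int_qpow; congr fermionic_int; apply/funext => x.
rewrite big_ord_recl tnth0 mulrA mulrAC; congr (_ * _ * _).
by apply: eq_bigr => j _; rewrite tnthS.
Qed.

(** The j-th variable carries the exponent [l + (r - j.+1)]; reversing the order
    of the factors gives the exponents [l + i]. *)
Lemma fermionic_mint_qEuler r l :
  fermionic_mint (fun xs : r.-tuple (padic_int T) =>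
    qpow q (l%:R * \sum_(j < r) tnth xs j) *
    qpow q (\sum_(j < r) (r%:Z - j.+1%:Z)%:~R * tnth xs j)) =
  2 ^+ r / \prod_(i < r) (1 + q ^+ i * q ^+ l).
Proof.
transitivity (fermionic_mint (fun xs : r.-tuple (padic_int T) =>
    1 * \prod_(j < r) qpow q ((l + (r - j.+1))%:R * tnth xs j))).
  congr fermionic_mint; apply/funext => xs.
  rewrite -qpowD mulr_sumr -big_split qpow_sumE mul1r; apply: eq_bigr => j _.
  by rewrite natrD mulrDl /= subzn.
rewrite (fermionic_mint_qpow _ (fun j => l + (r - j.+1)))%N mul1r.
rewrite prodf_div prodr_const card_ord; congr (_ / _).
rewrite (reindex_inj rev_ord_inj); apply: eq_bigr => i _ /=.
have -> : (r - (r - i.+1).+1 = i)%N := congr1 val (rev_ordK i).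
by rewrite addnC exprD.
Qed.

End QPowers.

(** * The q-binomial theorem and q-Stirling numbers *)

Section GaussBinomial.
Context {F : fieldType} (q : F).
Context (q_not_root1 : forall k : nat, (0 < k)%N -> q ^+ k != 1).

Definition qint (n : nat) : F := (1 - q ^+ n) / (1 - q).

Lemma q1_neq0 : 1 - q != 0.
Proof. by rewrite subr_eq0 eq_sym -[q]expr1 q_not_root1. Qed.

Lemma qint_neq0 n : (0 < n)%N -> qint n != 0.
Proof.
move=> n0; rewrite /qint mulf_neq0 ?invr_eq0 ?q1_neq0//.
by rewrite subr_eq0 eq_sym q_not_root1.
Qed.

Definition qint_fact m := \prod_(1 <= i < m.+1) qint i.

Lemma qint_factS m : qint_fact m.+1 = qint_fact m * qint m.+1.
Proof. by rewrite /qint_fact big_nat_recr. Qed.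

Lemma qint_fact_neq0 m : qint_fact m != 0.
Proof.
elim: m => [|m IH]; first by rewrite /qint_fact big_geq// oner_neq0.
by rewrite qint_factS mulf_neq0// qint_neq0.
Qed.

(** The factor [i = 0] is [qint r.+1], and [[r + 1] - [i + 1] = q ([r] - [i])]
    accounts for the others. *)
Lemma qint_ffact_succ r m :
  \prod_(i < m.+1) (qint r.+1 - qint i) =
  qint r.+1 * q ^+ m * \prod_(i < m) (qint r - qint i).
Proof.
rewrite big_ord_recl /= [in X in X * _]/qint expr0 subrr mul0r subr0 -mulrA.
congr (_ * _); transitivity (\prod_(i < m) (q * (qint r - qint i))).
  by apply: eq_bigr => i _; rewrite /qint !exprS; field; exact: q1_neq0.
by rewrite big_split prodr_const card_ord.
Qed.

(** The coefficients are the q-binomial coefficients times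
    [q ^+ 'C(m, 2)], since [[r] - [i] = q ^ i [r - i]].  This form needs no
    truncated subtraction, vanishes by itself for [m > r] and is the one that
    q-Stirling numbers produce.  The proof is the Pascal recurrence. *)
Lemma qbinomial r t :
  \prod_(i < r) (1 + q ^+ i * t) =
  \sum_(m < r.+1) (\prod_(i < m) (qint r - qint i)) / qint_fact m * t ^+ m.
Proof.
pose c r m := (\prod_(i < m) (qint r - qint i)) / qint_fact m.
have c0 s : c s 0%N = 1.
  by rewrite /c big_ord0 /qint_fact big_geq// divr1.
have c_top s : c s s.+1 = 0 by rewrite /c big_ord_recr /= subrr mulr0 mul0r.
have cS s m : c s.+1 m.+1 = c s m.+1 + q ^+ s * c s m.
  rewrite /c qint_ffact_succ big_ord_recr /= qint_factS.
  have f0 := qint_fact_neq0 m; have q0 := q1_neq0.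
  have := @qint_neq0 m.+1 isT; rewrite /qint mulf_eq0 negb_or => /andP[+ _].
  rewrite !exprS => m0.
  by field; rewrite f0 q0 m0.
suff : \prod_(i < r) (1 + q ^+ i * t) = \sum_(m < r.+1) c r m * t ^+ m by [].
elim: r => [|r IH]; first by rewrite big_ord0 big_ord1 c0 mul1r.
rewrite big_ord_recr /= IH [RHS]big_ord_recl c0 mul1r expr0.
under [in RHS]eq_bigr => m _ do rewrite lift0 cS mulrDl exprS.
rewrite big_split /= addrA mulrDr mulr1; congr (_ + _).
  rewrite [in RHS]big_ord_recr /= c_top mul0r addr0 big_ord_recl /= c0 mul1r.
  by rewrite expr0; congr (_ + _); apply: eq_bigr => m _; rewrite exprS.
by rewrite mulr_suml; apply: eq_bigr => m _; ring.
Qed.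

(** The left side is the polynomial [\prod_i (1 + [i] 'X)] at [- 1 / [r]],
    multiplied by [[r] ^+ m.+1]: of these factors [[r]], one is the factor
    [i = 0] on the right and the others turn each [1 - [i] / [r]] into
    [[r] - [i]].  The homogenised sum is computed by induction on the number
    of factors, without division by [[r]]. *)
Lemma stirling_ffact r m :
  \sum_(k < m.+2) (\prod_(1 <= i < m.+1) (1 + qint i *: 'X))`_k *
    (-1) ^+ k * qint r ^+ (m.+1 - k) = \prod_(i < m.+1) (qint r - qint i).
Proof.
pose P m := \prod_(1 <= i < m.+1) (1 + qint i *: 'X) : {poly F}.
have PS s : P s.+1 = P s * (1 + qint s.+1 *: 'X) by rewrite /P big_nat_recr.
have sP s : (size (P s) <= s.+1)%N.
  elim: s => [|s IH]; first by rewrite /P big_geq// size_poly1.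
  rewrite PS (leq_trans (size_polyMleq _ _))//.
  have : (size (1 + qint s.+1 *: 'X)%R <= 2)%N.
    rewrite (leq_trans (size_polyD _ _))// geq_max size_poly1 /=.
    by rewrite (leq_trans (size_scale_leq _ _))// size_polyX.
  by move: IH; lia.
have sumS s : \sum_(k < s.+2) (P s.+1)`_k * (-1) ^+ k * qint r ^+ (s.+1 - k) =
    (qint r - qint s.+1) *
    \sum_(k < s.+1) (P s)`_k * (-1) ^+ k * qint r ^+ (s - k).
  have coef0 k : ((P s) * (qint s.+1 *: 'X))`_k =
      qint s.+1 * (if k is k'.+1 then (P s)`_k' else 0).
    by rewrite -scalerAr coefZ coefMX; case: k.
  transitivity (\sum_(k < s.+2) (P s)`_k * (-1) ^+ k * qint r ^+ (s.+1 - k) +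
     \sum_(k < s.+2) (qint s.+1 * (if (k : nat) is k'.+1 then (P s)`_k' else 0)) *
       (-1) ^+ k * qint r ^+ (s.+1 - k)).
    rewrite -big_split; apply: eq_bigr => k _ /=.
    by rewrite PS mulrDr mulr1 coefD coef0 !mulrDl.
  rewrite mulrBl; congr (_ + _).
    rewrite big_ord_recr /= nth_default ?sP// !mul0r addr0 mulr_sumr.
    by apply: eq_bigr => k _; rewrite subSn ?leq_ord// exprS; ring.
  rewrite big_ord_recl /= mulr0 !mul0r add0r -mulNr mulr_sumr.
  by apply: eq_bigr => k _; rewrite subSS exprS; ring.
have sumE s : \sum_(k < s.+1) (P s)`_k * (-1) ^+ k * qint r ^+ (s - k) =
    \prod_(i < s) (qint r - qint i.+1).
  elim: s => [|s IH]; last by rewrite sumS IH big_ord_recr mulrC.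
  by rewrite big_ord1 big_ord0 /P big_geq// coef1 !mulr1.
rewrite big_ord_recl [qint (@ord0 m)]/qint expr0 subrr mul0r subr0.
rewrite -sumE big_ord_recr /= -/(P m) nth_default ?sP// !mul0r addr0 mulr_sumr.
by apply: eq_bigr => k _; rewrite subSn ?leq_ord// exprS; ring.
Qed.

Lemma qint_expr_expand n (Q : F) :
  ((1 - Q) / (1 - q)) ^+ n =
  1 / (1 - q) ^+ n * \sum_(l < n.+1) ('C(n, l)%:R * (-1) ^+ l * Q ^+ l).
Proof.
rewrite expr_div_n mulrC mul1r; congr (_ * _).
rewrite exprBn; apply: eq_bigr => l _.
by rewrite expr1n mulr1 -mulr_natl mulrA.
Qed.
End GaussBinomial.

(** * Evaluation of the q-Euler polynomials *)

Lemma qnum_nat {R : realType} {p : nat} (p_prime : prime p) {T : padic_tower R p}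
  {q : Cp T} (q_near1 : vabs (1 - q) < 1) (n : nat) :
  qnum q (n%:R : padic_int T) = qint q n.
Proof. by rewrite /qnum qpow_nat. Qed.

(** For [m = 0] this relies on the convention [S_1(-1, 0; q) = 1]. *)
Lemma qStirling1_ffact {R : realType} {p : nat} (p_prime : prime p)
  {T : padic_tower R p} {q : Cp T} (q_near1 : vabs (1 - q) < 1) (r m : nat) :
  \sum_(k < m.+1) qStirling1 q (m%:Z - 1) k * (-1) ^+ k * qint q r ^+ (m - k) =
  \prod_(i < m) (qint q r - qint q i).
Proof.
case: m => [|m].
  by rewrite big_ord1 big_ord0 sub0r /= !mulr1.
rewrite -stirling_ffact -[m.+1%:Z]/(1 + m%:Z) addrC addKr /qStirling1.
by under eq_bigr => i _ do rewrite qnum_nat//.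
Qed.

Theorem proposition7 (R : realType) (p : nat) (p_prime : prime p)
    (p_odd : odd p) (T : padic_tower R p) (q : Cp T)
    (q_near1 : vabs (1 - q) < 1)
    (q_not_root1 : forall k : nat, (0 < k)%N -> q ^+ k != 1)
    (x : padic_int T) (r : nat) (r_ge1 : (1 <= r)%N) (n : nat) :
  qEuler q r%:Z r n x =
    1 / 2 ^+ r *
    \sum_(m < r.+1)
      1 / qfact q m *
      \sum_(k < m.+1)
        qStirling1 q (m%:Z - 1) k * (-1) ^+ k *
        qnum q (r%:R : padic_int T) ^+ (m - k) * qnum q (x + m%:R) ^+ n.
Proof.
pose c m := \prod_(i < m) (qint q r - qint q i) / qint_fact q m.
transitivity (1 / (1 - q) ^+ n * \sum_(l < n.+1) 'C(n, l)%:R * (-1) ^+ l *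
    qpow q x ^+ l * (1 / 2 ^+ r * \sum_(m < r.+1) c m * (q ^+ l) ^+ m)).
  congr (_ * _); apply: eq_bigr => l _.
  rewrite fermionic_mint_qEuler// invf_div qpowMn// qbinomial//.
  by congr (_ * _); rewrite mul1r mulrC.
transitivity (1 / 2 ^+ r * \sum_(m < r.+1) c m * (1 / (1 - q) ^+ n *
    \sum_(l < n.+1) 'C(n, l)%:R * (-1) ^+ l * (qpow q x * q ^+ m) ^+ l)).
  rewrite mulr_sumr; under eq_bigr => l _ do rewrite !mulr_sumr.
  rewrite exchange_big mulr_sumr; apply: eq_bigr => m _.
  rewrite !mulr_sumr; apply: eq_bigr => l _.
  by rewrite exprMn exprAC; ring.
congr (_ * _); apply: eq_bigr => m _.
rewrite -qint_expr_expand -qpow_nat// -qpowD// -/(qnum q (x + m%:R)).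
under [in RHS]eq_bigr => k _ do rewrite qnum_nat//.
rewrite -mulr_suml qStirling1_ffact// mulrA; congr (_ * _).
rewrite mul1r [RHS]mulrC /c; congr (_ * _^-1).
by apply: eq_bigr => i _; rewrite qnum_nat.
Qed.
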